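(* Let $0\le a<b$, let $s\in(0,1]$, and let $f:[a,b]\to\mathbb{R}$ be a function such that $f'$ is absolutely continuous on $[a,b]$ and $f''\in L_1[a,b]$. If $|f''|$ is $s$-convex on $[a,b]$, then for all $x\in\left[a,\frac{a+b}{2}\right]$ $$\left|\frac{1}{b-a}\int_a^b f(t)\,dt-\frac12\left[f(x)+f(a+b-x)\right]+\frac12\left(x-\frac{3a+b}{4}\right)\left[f'(x)-f'(a+b-x)\right]\right|$$ $$\le \frac{(x-a)^3}{(s+1)(s+2)(s+3)(b-a)}\left[|f''(a)|+|f''(b)|\right]+\frac{4(s^2+3s+2)(x-a)^3+(s^2+s+2)(a+b-2x)^3}{8(s+1)(s+2)(s+3)(b-a)}\left[|f''(x)|+|f''(a+b-x)|\right].$$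
   Context: For $s\in(0,1]$ and an interval $J\subseteq[0,\infty)$, a function $g:J\to\mathbb{R}$ is called $s$-convex (in the second sense) on $J$ if $g(\alpha u+\beta v)\le \alpha^s g(u)+\beta^s g(v)$ for all $u,v\in J$ and all $\alpha,\beta\ge 0$ with $\alpha+\beta=1$. The assumption that $|f''|$ is $s$-convex on $[a,b]$ presupposes that $f''$ is defined at every point of $[a,b]$ (one-sided at the endpoints). *)

(* Defs.v *)
From mathcomp Require Export all_boot all_order all_algebra.
From mathcomp Require Export all_classical all_reals all_analysis.

Set Implicit Arguments.
Unset Strict Implicit.
Unset Printing Implicit Defensive.

Export Order.TTheory GRing.Theory Num.Theory.
Export numFieldNormedType.Exports.
Local Open Scope classical_set_scope.
Local Open Scope ring_scope.

(* Functions on an interval J are total functions R -> R of which only the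
   values on J matter.  Accordingly, the derivative below is relative to J: it
   is the usual two-sided one at interior points of J and the one-sided one at
   endpoints of J. *)
Definition diff_quotient (R : realType) (g : R -> R) (x y : R) : R :=
  (g y - g x) / (y - x).

Definition derivable_on (R : realType) (J : interval R) (g : R -> R) : Prop :=
  forall x : R, x \in J ->
    cvg (diff_quotient g x y @[y --> within [set` J] x^']).

Definition derive_on (R : realType) (J : interval R) (g : R -> R) (x : R) : R :=
  lim (diff_quotient g x y @[y --> within [set` J] x^']).

Definition absolutely_continuous_on (R : realType) (a b : R) (g : R -> R) :
    Prop :=
  forall eps : R, 0 < eps -> exists2 delta : R, 0 < delta &
    forall (n : nat) (u v : 'I_n -> R),
      (forall i, a <= u i /\ u i <= v i /\ v i <= b) ->
      trivIset setT (fun i => `]u i, v i[%classic) ->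
      \sum_(i < n) (v i - u i) < delta ->
      \sum_(i < n) `|g (v i) - g (u i)| < eps.

(* s-convexity in the second sense; meant for 0 < s <= 1 and J included in
   [0, +oo[.  Recall that 0 `^ s = 0 when s != 0. *)
Definition s_convex (R : realType) (s : R) (J : interval R) (g : R -> R) :
    Prop :=
  forall u v alpha beta : R, u \in J -> v \in J ->
    0 <= alpha -> 0 <= beta -> alpha + beta = 1 ->
    g (alpha * u + beta * v) <= alpha `^ s * g u + beta `^ s * g v.

(* Main.v *)
Require Import Defs.
From mathcomp Require Import ring lra.
Local Open Scope classical_set_scope.
Local Open Scope ring_scope.

(** Let [F] be the primitive of [f] given by the integral from [a], and for a
    centre [c] put [T_c(t) = 2 F(t) - 2 (t - c) f(t) + (t - c)^2 f'(t)].  The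
    terms in [f] and [f'] cancel on differentiation, leaving
    [T_c'(t) = (t - c)^2 f''(t)].  Write [m = (a + b) / 2] and
    [y = a + b - x].  The left-hand side of the theorem, times [2 (b - a)], is
    the absolute value of the sum of the increments of [T_a] over [[a, x]], of
    [T_m] over [[x, y]] and of [T_b] over [[y, b]]: the jumps between the three
    centres produce exactly the values of [f] and [f'] at [x] and [y].

    On each piece [[p, q]], s-convexity bounds [|f''(t)|] by
    [((q - t)/(q - p))^s |f''(p)| + ((t - p)/(q - p))^s |f''(q)|].  After
    multiplication by [(t - c)^2] this bound has an explicit primitive
    ([kernel_primitive]), so the mean value theorem compares the increment of
    [T_c] with that of the primitive ([norm_increment_le]), which is
    [taylor_primitive_increment].  Adding up the three pieces gives the stated
    coefficients ([perturbed_trapezoid_bound]).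

    As [f''] exists at every point, the comparison is made on pointwise
    derivatives; the integral of [f] enters through the fundamental theorem of
    calculus for continuous functions. *)

Section PerturbedTrapezoid.
Set Implicit Arguments.
Unset Strict Implicit.
Context {R : realType}.
Implicit Types a b c d h p q s t w x : R.

(** * Relative derivatives on a segment *)

Lemma within_itv_dnbhs a b x : x \in `]a, b[ -> within `[a, b] x^' = x^'.
Proof.
move=> xab; rewrite eqEsubset; split => U; rewrite /within /=; last first.
  by apply: filterS.
have : \forall y \near x^', `[a, b]%classic y.
  apply: nbhs_dnbhs; near=> y; apply: subset_itv_oo_cc.
  by near: y; apply: near_in_itvoo.
by apply: filterS2 => y yab; apply.
Unshelve. all: end_near. Qed.

Lemma derivable_on_is_derive a b (g : R -> R) x : x \in `]a, b[ ->
  derivable_on `[a, b] g -> is_derive x 1 g (derive_on `[a, b] g x).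
Proof.
move=> xab dg.
have := dg x (subset_itv_oo_cc xab).
rewrite /derive_on (within_itv_dnbhs xab) => cg.
have E : diff_quotient g x y @[y --> x^'] =
    h^-1 *: ((g \o shift x) (h *: 1) - g x) @[h --> 0^'].
  apply/funext => U; rewrite /fmap/= !near_simpl !near_withinE.
  (* the substitution [y = h + x] *)
  apply: etrans (@near_shift _ R^o 0 x _) _.
  rewrite subr0; apply: eq_near => h /=.
  by rewrite /diff_quotient -subr_eq0 addrK mulrC [h *: 1]mulr1.
by split; rewrite /derivable /derive -E.
Qed.

Lemma derivable_on_continuous a b (g : R -> R) :
  derivable_on `[a, b] g -> {within `[a, b], continuous g}.
Proof.
move=> dg; apply/subspace_continuousP => x xab.
have cg := dg x xab.
(* away from [x] this product is [g y - g x] *)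
have k0 :
    (diff_quotient g x y * (y - x)) @[y --> within `[a, b] x^'] --> 0.
  rewrite -(mulr0 (derive_on `[a, b] g x)); apply: cvgM => //.
  have : (y - x) @[y --> x] --> (x - x) by apply: cvgB => //; exact: cvg_cst.
  rewrite subrr; apply: cvg_trans; apply: cvg_app.
  by move=> U xU; apply: filterS xU => y Uy _ _.
apply/cvgrPdist_lt => e e0.
move/cvgr0_norm_lt : k0 => /(_ e e0).
rewrite !near_withinE; apply: filterS => y ky yab.
have [->|yx] := eqVneq y x; first by rewrite subrr normr0.
by have := ky yx yab; rewrite distrC /diff_quotient divfK // subr_eq0.
Qed.

(** * Comparison of increments *)

(** The absolute value makes the power continuous across [0] (a power of a
    negative number is [1] by convention), so that it can be composed and then
    restricted to a set where the argument is nonnegative. *)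
Lemma normr_powR_continuous r : 0 < r -> continuous (fun u : R => `|u| `^ r).
Proof.
move=> r0 u; have [->|u0] := eqVneq u 0; last first.
  apply: (@cvg_comp _ _ _ (fun v : R => `|v|) (fun v => v `^ r) _ (nbhs `|u|)).
    exact: (@norm_continuous _ R^o).
  suff : {for `|u|, continuous (fun v : R => v `^ r)} by [].
  apply/differentiable_continuous/derivable1_diffP/derivable_powR.
  by rewrite in_itv/= andbT normr_gt0.
apply/cvgrPdist_lt => e e0; near=> v.
rewrite normr0 powR0 ?gt_eqF// sub0r normrN ger0_norm ?powR_ge0//.
(* [|v|^r < e] as soon as [|v| < e^(1/r)] *)
rewrite -[ltRHS](@powRr1 _ e) ?ltW//.
rewrite -[X in _ < _ `^ X](mulVf (lt0r_neq0 r0)) powRrM.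
rewrite gt0_ltr_powR// ?nnegrE ?powR_ge0//.
near: v; apply: (@cvgr0_norm_lt _ R^o _ (nbhs (0:R)) _ id) => //.
by rewrite powR_gt0.
Unshelve. all: end_near. Qed.

(** The mean value theorem for [H - G] and [H + G], whose derivatives are
    nonnegative.  It plays the part of the inequality between the integrals of
    [|g|] and [h]. *)
Lemma norm_increment_le (G H g h : R -> R) p q : p <= q ->
  (forall t, t \in `]p, q[ -> is_derive t 1 G (g t)) ->
  (forall t, t \in `]p, q[ -> is_derive t 1 H (h t)) ->
  {within `[p, q], continuous G} -> {within `[p, q], continuous H} ->
  (forall t, t \in `]p, q[ -> `|g t| <= h t) ->
  `|G q - G p| <= H q - H p.
Proof.
rewrite le_eqVlt => /predU1P[<-|pq]; first by rewrite !subrr normr0.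
move=> dG dH cG cH gh.
have dB t : t \in `]p, q[ -> is_derive t 1 (H - G) (h t - g t).
  by move=> tpq; apply: is_deriveB; [exact: dH|exact: dG].
have dD t : t \in `]p, q[ -> is_derive t 1 (H + G) (h t + g t).
  by move=> tpq; apply: is_deriveD; [exact: dH|exact: dG].
have [t tpq E1] := MVT pq dB (within_continuousB cH cG).
have [u upq E2] := MVT pq dD (within_continuousD cH cG).
have ht : 0 <= (h t - g t) * (q - p).
  have /ler_normlP[_ ?] := gh t tpq.
  by rewrite mulr_ge0 ?subr_ge0 // ltW.
have hu : 0 <= (h u + g u) * (q - p).
  have /ler_normlP[? _] := gh u upq.
  by rewrite mulr_ge0 ?subr_ge0 -?lerBlDr ?sub0r // ltW.
apply/ler_normlP; move: E1 E2; rewrite !fctE => E1 E2; split; lra.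
Qed.

(** * The primitive of a continuous function *)

Lemma integral_is_derive a b (f : R -> R) t :
  {within `[a, b], continuous f} -> t \in `]a, b[ ->
  is_derive t 1 (fun u => (\int[lebesgue_measure]_(v in `[a, u]) f v)) (f t).
Proof.
move=> cf tab.
have fi : lebesgue_measure.-integrable `[a, b] (EFin \o f).
  by apply: continuous_compact_integrable => //; exact: segment_compact.
have [a_t tb] : a < t /\ t < b by move: tab; rewrite in_itv/= => /andP[].
have cft : {for t, continuous f}.
  exact: (within_continuous_continuous (lt_trans a_t tb) cf).
have [dF <-] := continuous_FTC1_closed tb fi a_t cft.
by rewrite derive1E; exact: derivableP.
Qed.

Lemma integral_continuous a b (f : R -> R) : a <= b ->
  {within `[a, b], continuous f} ->
  {within `[a, b],
    continuous (fun u => (\int[lebesgue_measure]_(v in `[a, u]) f v))}.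
Proof.
move=> ab cf; apply: parameterized_integral_continuous => //.
by apply: continuous_compact_integrable => //; exact: segment_compact.
Qed.

(** * Primitives of the weight and of the kernel *)

(** The primitive, vanishing at [0], of [(w / h)^s (w - d)^2] on [w > 0]; the
    factor of exponent [s + 1 > 0] also makes it continuous at [0]. *)
Definition kernel_primitive (s h d w : R) : R :=
  h * (w / h) `^ (s + 1) *
  (w ^+ 2 / (s + 3) - 2 * d * w / (s + 2) + d ^+ 2 / (s + 1)).

(** The integral of [(w / h)^s (w - d)^2] over [[0, h]]. *)
Definition power_moment (s h d : R) : R :=
  h * (h ^+ 2 / (s + 3) - 2 * d * h / (s + 2) + d ^+ 2 / (s + 1)).

(** The result of integrating [(t - c)^2 f''(t)] twice by parts, with [F]
    standing for a primitive of [f]. *)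
Definition taylor_primitive (F f f' : R -> R) (c t : R) : R :=
  2 * F t - 2 * (t - c) * f t + (t - c) ^+ 2 * f' t.

Lemma kernel_primitive0 s h d : 0 < s -> kernel_primitive s h d 0 = 0.
Proof.
move=> s0.
by rewrite /kernel_primitive mul0r powR0 ?mulr0 ?mul0r // gt_eqF ?addr_gt0.
Qed.

Lemma kernel_primitive_moment s h d : 0 < h ->
  kernel_primitive s h d h = power_moment s h d.
Proof.
by move=> h0; rewrite /kernel_primitive divff ?gt_eqF // powR1 mulr1.
Qed.

Lemma is_derive_kernel_primitive s h d (w : R -> R) t dw :
  0 < s -> 0 < h -> 0 < w t -> is_derive t 1 w dw ->
  is_derive t 1 (fun u => kernel_primitive s h d (w u))
    ((w t / h) `^ s * (w t - d) ^+ 2 * dw).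
Proof.
move=> s0 h0 wt0 dwt.
have wh0 : 0 < w t / h by rewrite divr_gt0.
have dp : is_derive t 1 (fun u => (w u / h) `^ (s + 1))
    ((s + 1) * (w t / h) `^ s * (dw / h)).
  have dwh : is_derive t 1 (fun u => w u / h) (dw / h).
    rewrite (_ : (fun u => _) = w * cst h^-1) //.
    by apply: is_derive_eq; rewrite scaler0 add0r [LHS]mulrC.
  have := is_derive1_powR (s + 1) wh0.
  rewrite addrK => dpw.
  exact: (@is_derive1_comp _ (fun v => v `^ (s + 1)) (fun u => w u / h)).
rewrite (_ : (fun u => _) = cst h * (fun u => (w u / h) `^ (s + 1)) *
  (w ^+ 2 * cst (s + 3)^-1 - cst (2 * d) * w * cst (s + 2)^-1
   + cst (d ^+ 2 / (s + 1)))) //.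
apply: is_derive_eq; rewrite !fctE /= !scaler0 !addr0 ?add0r.
rewrite powRD ?(gt_eqF wh0) ?implybT // powRr1 ?ltW // /GRing.scale /=.
field.
by rewrite !gt_eqF ?addr_gt0.
Qed.

Lemma kernel_primitive_continuous s h d (w : R -> R) (A : set R) :
  0 < s -> 0 < h -> continuous w -> (forall t, A t -> 0 <= w t) ->
  {within A, continuous (fun u => kernel_primitive s h d (w u))}.
Proof.
move=> s0 h0 cw w0.
(* on [A] the argument of the power may be replaced by its absolute value *)
apply: (@subspace_eq_continuous _ _ _ (fun u => h * `|w u / h| `^ (s + 1) *
  (w u ^+ 2 / (s + 3) - 2 * d * w u / (s + 2) + d ^+ 2 / (s + 1)))).
  move=> u /[!inE] Au /=.
  by rewrite /from_subspace /kernel_primitive ger0_norm // divr_ge0 ?w0 // ltW.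
apply: continuous_subspaceT => u.
have cd : (fun u => w u / h) @ u --> w u / h by apply: cvgMl; exact: cw.
apply: cvgM.
  have cs : {for w u / h, continuous (fun v : R => `|v| `^ (s + 1))}.
    by apply: normr_powR_continuous; rewrite addr_gt0.
  by apply: cvgMr; exact: cvg_comp cd cs.
apply: cvgD; last exact: cvg_cst.
apply: cvgB.
  by apply: cvgMl; rewrite expr2; apply: cvgM; exact: cw.
by apply: cvgMl; apply: cvgMr; exact: cw.
Qed.

Lemma is_derive_taylor_primitive (F f f' : R -> R) c t (f''t : R) :
  is_derive t 1 F (f t) -> is_derive t 1 f (f' t) -> is_derive t 1 f' f''t ->
  is_derive t 1 (taylor_primitive F f f' c) ((t - c) ^+ 2 * f''t).
Proof.
move=> dF df df'.
have dl : is_derive t 1 (fun u => u - c) (1 - 0).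
  exact: is_deriveB (is_derive_id t 1) (is_derive_cst c t 1).
apply: is_derive_eq (is_deriveD (is_deriveB (is_deriveZ 2 dF)
  (is_deriveM (is_deriveZ 2 dl) df)) (is_deriveM (is_deriveM dl dl) df')) _.
by rewrite !fctE /GRing.scale /= -[2 *: _]/(2 * _); ring.
Qed.

Lemma taylor_primitive_continuous (F f f' : R -> R) c (A : set R) :
  {within A, continuous F} -> {within A, continuous f} ->
  {within A, continuous f'} ->
  {within A, continuous (taylor_primitive F f f' c)}.
Proof.
move=> cF cf cf'.
have cl : {within A, continuous (fun t => t - c)}.
  by apply: continuous_subspaceT => u; apply: cvgB => //; exact: cvg_cst.
move=> u; apply: cvgD; last first.
  by apply: cvgM; [rewrite expr2; apply: cvgM; exact: cl|exact: cf'].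
apply: cvgB; first by apply: cvgMr; exact: cF.
by apply: cvgM; [apply: cvgMr; exact: cl|exact: cf].
Qed.

(** * The estimate on one piece *)

(** In the variables [q - t] and [t - p], which vanish where the weights of
    [A] and [B] do, [(t - c)^2] is [((q - t) - (q - c))^2] and
    [((t - p) - (c - p))^2]; hence the two moments. *)
Lemma taylor_primitive_increment (F f f' f'' : R -> R) s A B c p q :
  0 < s -> p <= q ->
  {within `[p, q], continuous F} -> {within `[p, q], continuous f} ->
  {within `[p, q], continuous f'} ->
  (forall t, t \in `]p, q[ -> is_derive t 1 F (f t)) ->
  (forall t, t \in `]p, q[ -> is_derive t 1 f (f' t)) ->
  (forall t, t \in `]p, q[ -> is_derive t 1 f' (f'' t)) ->
  (forall t, t \in `]p, q[ ->
     `|f'' t| <= ((q - t) / (q - p)) `^ s * A + ((t - p) / (q - p)) `^ s * B) ->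
  `|taylor_primitive F f f' c q - taylor_primitive F f f' c p| <=
    A * power_moment s (q - p) (q - c) + B * power_moment s (q - p) (c - p).
Proof.
move=> s0; rewrite le_eqVlt => /predU1P[<-|pq].
  by rewrite /power_moment !subrr normr0 !mul0r !mulr0 addr0.
move=> cF cf cf' dF df df' hf''.
have h0 : 0 < q - p by rewrite subr_gt0.
(* a primitive of the upper bound for [(t - c)^2 |f'' t|] *)
pose H t := B * kernel_primitive s (q - p) (c - p) (t - p)
            - A * kernel_primitive s (q - p) (q - c) (q - t).
rewrite -!(@kernel_primitive_moment s) //.
have -> : A * kernel_primitive s (q - p) (q - c) (q - p) +
    B * kernel_primitive s (q - p) (c - p) (q - p) = H q - H p.
  by rewrite /H !subrr !kernel_primitive0 // !mulr0; ring.
pose H' t := (t - c) ^+ 2 *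
  (((q - t) / (q - p)) `^ s * A + ((t - p) / (q - p)) `^ s * B).
apply: (@norm_increment_le _ _ (fun t => (t - c) ^+ 2 * f'' t) H').
- exact: ltW.
- move=> t tpq; apply: is_derive_taylor_primitive.
  + exact: dF.
  + exact: df.
  + exact: df'.
- move=> t /[1!in_itv] /= /andP[pt tq].
  have d1 : is_derive t 1
      (fun u => kernel_primitive s (q - p) (c - p) (u - p))
      (((t - p) / (q - p)) `^ s * (t - p - (c - p)) ^+ 2 * (1 - 0)).
    apply: (@is_derive_kernel_primitive _ _ _ (fun u => u - p)) => //.
    by rewrite subr_gt0.
  have d2 : is_derive t 1
      (fun u => kernel_primitive s (q - p) (q - c) (q - u))
      (((q - t) / (q - p)) `^ s * (q - t - (q - c)) ^+ 2 * (0 - 1)).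
    apply: (@is_derive_kernel_primitive _ _ _ (fun u => q - u)) => //.
    by rewrite subr_gt0.
  apply: is_derive_eq (is_deriveB (is_deriveZ B d1) (is_deriveZ A d2)) _.
  by rewrite /H' /GRing.scale /=; ring.
- exact: taylor_primitive_continuous.
- have c1 : {within `[p, q], continuous
      (fun u => kernel_primitive s (q - p) (c - p) (u - p))}.
    apply: (@kernel_primitive_continuous _ _ _ (fun u => u - p)) => //.
      by move=> u; apply: cvgB => //; exact: cvg_cst.
    by move=> t /=; rewrite in_itv/= subr_ge0 => /andP[].
  have c2 : {within `[p, q], continuous
      (fun u => kernel_primitive s (q - p) (q - c) (q - u))}.
    apply: (@kernel_primitive_continuous _ _ _ (fun u => q - u)) => //.
      by move=> u; apply: cvgB => //; exact: cvg_cst.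
    by move=> t /=; rewrite in_itv/= subr_ge0 => /andP[].
  by move=> u; apply: cvgB; apply: cvgMr; [exact: c1|exact: c2].
- move=> t tpq; rewrite normrM ger0_norm ?sqr_ge0 // /H'.
  by rewrite ler_wpM2l ?sqr_ge0 // hf''.
Qed.

Lemma s_convex_chord s (J : interval R) (g : R -> R) p q t :
  s_convex s J g -> p \in J -> q \in J -> t \in `]p, q[ ->
  g t <= ((q - t) / (q - p)) `^ s * g p + ((t - p) / (q - p)) `^ s * g q.
Proof.
move=> cg pJ qJ; rewrite in_itv/= => /andP[pt tq].
have pq := lt_trans pt tq.
have qp0 : q - p != 0 by rewrite subr_eq0 gt_eqF.
rewrite -[in leLHS](_ : (q - t) / (q - p) * p + (t - p) / (q - p) * q = t).
  2: by field.
apply: cg => //; last by field.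
  by rewrite divr_ge0 ?subr_ge0 ?ltW.
by rewrite divr_ge0 ?subr_ge0 ?ltW.
Qed.

Lemma taylor_primitive_increment_s_convex (F f f' f'' : R -> R) a b s c p q :
  0 < s -> a <= p -> p <= q -> q <= b ->
  {within `[a, b], continuous F} -> {within `[a, b], continuous f} ->
  {within `[a, b], continuous f'} ->
  (forall t, t \in `]a, b[ -> is_derive t 1 F (f t)) ->
  (forall t, t \in `]a, b[ -> is_derive t 1 f (f' t)) ->
  (forall t, t \in `]a, b[ -> is_derive t 1 f' (f'' t)) ->
  s_convex s `[a, b] (fun t => `|f'' t|) ->
  `|taylor_primitive F f f' c q - taylor_primitive F f f' c p| <=
    `|f'' p| * power_moment s (q - p) (q - c)
  + `|f'' q| * power_moment s (q - p) (c - p).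
Proof.
move=> s0 ap pq qb cF cf cf' dF df df' cvx.
have pqab : `[p, q]%classic `<=` `[a, b]%classic.
  by apply: subset_itv; rewrite bnd_simp.
have pqab_oo t : t \in `]p, q[ -> t \in `]a, b[.
  by rewrite !in_itv/= => /andP[/(le_lt_trans ap)-> /lt_le_trans->].
refine (taylor_primitive_increment c s0 pq (continuous_subspaceW pqab cF)
  (continuous_subspaceW pqab cf) (continuous_subspaceW pqab cf')
  (fun t tpq => dF t (pqab_oo t tpq)) (fun t tpq => df t (pqab_oo t tpq))
  (fun t tpq => df' t (pqab_oo t tpq)) _).
move=> t tpq; apply: (s_convex_chord cvx) => //.
  by rewrite in_itv /= ap (le_trans pq).
by rewrite in_itv /= qb (le_trans ap).
Qed.

(** * The three pieces together *)

(** In the sum of the three increments, [f x] has the coefficient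
    [-2 (x - a) + 2 (x - m) = -(b - a)] and [f' x] has
    [(x - a)^2 - (x - m)^2 = (b - a) (x - (3 a + b) / 4)], where
    [m = (a + b) / 2]; those at [a + b - x] follow by symmetry. *)
Lemma perturbed_trapezoid_bound (F f f' f'' : R -> R) a b s x :
  0 < s -> a < b ->
  {within `[a, b], continuous F} -> {within `[a, b], continuous f} ->
  {within `[a, b], continuous f'} ->
  (forall t, t \in `]a, b[ -> is_derive t 1 F (f t)) ->
  (forall t, t \in `]a, b[ -> is_derive t 1 f (f' t)) ->
  (forall t, t \in `]a, b[ -> is_derive t 1 f' (f'' t)) ->
  s_convex s `[a, b] (fun t => `|f'' t|) ->
  a <= x -> x <= (a + b) / 2 ->
  `| 1 / (b - a) * (F b - F a)
     - 1 / 2 * (f x + f (a + b - x))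
     + 1 / 2 * (x - (3 * a + b) / 4) * (f' x - f' (a + b - x)) |
  <= (x - a) ^+ 3 / ((s + 1) * (s + 2) * (s + 3) * (b - a))
       * (`|f'' a| + `|f'' b|)
   + (4 * (s ^+ 2 + 3 * s + 2) * (x - a) ^+ 3
      + (s ^+ 2 + s + 2) * (a + b - 2 * x) ^+ 3)
       / (8 * (s + 1) * (s + 2) * (s + 3) * (b - a))
       * (`|f'' x| + `|f'' (a + b - x)|).
Proof.
move=> s0 ab cF cf cf' dF df df' cvx ax xm.
have ba0 : 0 < b - a by rewrite subr_gt0.
have xy : x <= a + b - x by lra.
have yb : a + b - x <= b by lra.
have piece c p q (ap : a <= p) (pq : p <= q) (qb : q <= b) :=
  taylor_primitive_increment_s_convex c s0 ap pq qb cF cf cf' dF df df' cvx.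
have P1 := piece a a x (lexx a) ax (le_trans xy yb).
have P2 := piece ((a + b) / 2) x (a + b - x) ax xy yb.
have P3 := piece b (a + b - x) b (le_trans ax xy) yb (lexx b).
have := lerD (lerD P1 P2) P3.
have D0 : 0 < (2 * (b - a))^-1 by rewrite invr_gt0 mulr_gt0.
clear piece P1 P2 P3.
rewrite -(ler_pM2l D0) => le_sum.
have -> : 1 / (b - a) * (F b - F a) - 1 / 2 * (f x + f (a + b - x)) +
    1 / 2 * (x - (3 * a + b) / 4) * (f' x - f' (a + b - x)) =
  (2 * (b - a))^-1 *
  (taylor_primitive F f f' a x - taylor_primitive F f f' a a +
   (taylor_primitive F f f' ((a + b) / 2) (a + b - x) -
    taylor_primitive F f f' ((a + b) / 2) x) +
   (taylor_primitive F f f' b b - taylor_primitive F f f' b (a + b - x))).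
  rewrite /taylor_primitive.
  by field; rewrite gt_eqF.
rewrite normrM (gtr0_norm D0).
apply: le_trans (ler_wpM2l (ltW D0) _) (le_trans le_sum _).
  by apply: le_trans (ler_normD _ _) _; rewrite lerD2r ler_normD.
clear le_sum.
(* the sum of the three bounds is the right-hand side itself *)
rewrite le_eqVlt; apply/orP; left; apply/eqP.
rewrite /power_moment.
by field; rewrite (gt_eqF ba0) !gt_eqF ?addr_gt0.
Qed.

End PerturbedTrapezoid.

Theorem theorem4 (R : realType) (a b s : R) (f : R -> R)
    (f' := derive_on `[a, b] f) (f'' := derive_on `[a, b] f') :
  0 <= a -> a < b -> 0 < s -> s <= 1 ->
  derivable_on `[a, b] f ->
  derivable_on `[a, b] f' ->
  absolutely_continuous_on a b f' ->
  lebesgue_measure.-integrable `[a, b]%classic (EFin \o f'') ->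
  s_convex s `[a, b] (fun t => `|f'' t|) ->
  forall x : R, a <= x -> x <= (a + b) / 2 ->
  `| 1 / (b - a) * (\int[lebesgue_measure]_(t in `[a, b]%classic) f t)
     - 1 / 2 * (f x + f (a + b - x))
     + 1 / 2 * (x - (3 * a + b) / 4) * (f' x - f' (a + b - x)) |
  <= (x - a) ^+ 3 / ((s + 1) * (s + 2) * (s + 3) * (b - a))
       * (`|f'' a| + `|f'' b|)
   + (4 * (s ^+ 2 + 3 * s + 2) * (x - a) ^+ 3
      + (s ^+ 2 + s + 2) * (a + b - 2 * x) ^+ 3)
       / (8 * (s + 1) * (s + 2) * (s + 3) * (b - a))
       * (`|f'' x| + `|f'' (a + b - x)|).
Proof.
move=> _ ab s0 _ df df' _ _ cvx x ax xm.
pose F u := \int[lebesgue_measure]_(v in `[a, u]%classic) f v.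
have cf := derivable_on_continuous df.
have dF t : t \in `]a, b[ -> is_derive t 1 F (f t).
  exact: integral_is_derive cf.
have cF : {within `[a, b]%classic, continuous F}.
  exact: integral_continuous (ltW ab) cf.
have Fa : F a = 0 by rewrite /F set_itv1 Rintegral_set1.
rewrite -[\int[_]_(t in _) _](subr0 (F b)) -{1}Fa.
refine (perturbed_trapezoid_bound s0 ab cF cf (derivable_on_continuous df')
  dF _ _ cvx ax xm).
- by move=> t tab; exact: derivable_on_is_derive.
- by move=> t tab; exact: derivable_on_is_derive.
Qed.
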